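(* There exist absolute constants $\delta_0>0$ and $C_0>1$ such that for every non-negative integer $k$, every group $G$ of rank $k$ has a finite (multi-)subset $A$ with $|A|\le C_0\cdot k$ and $\delta(A;G)\ge\delta_0$.
   Context: The rank of a finitely generated group $G$ is the minimal size of a generating set of $G$. A multi-subset of $G$ is a finite unordered collection of elements of $G$, possibly with repetitions; $|A|$ counts elements with multiplicity, and for $H\le G$, $A\cap H$ denotes the multi-set of those elements of $A$ (with multiplicity) lying in $H$. The detection probability of $A$ in $G$ is $\delta(A;G)=\inf\{1-\frac{|A\cap H|}{|A|} : H\lneq G\}$, the infimum running over all proper subgroups $H$ of $G$; thus $\delta(A;G)\ge\delta_0$ means $|A\cap H|\le(1-\delta_0)|A|$ for every proper subgroup $H$ of $G$. *)

(* Defs.v *)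
From mathcomp Require Import all_boot all_order all_algebra.
From mathcomp Require Import finmap multiset.
From mathcomp Require Import boolp classical_sets reals constructive_ereal ereal.

Set Implicit Arguments.
Unset Strict Implicit.
Unset Printing Implicit Defensive.

Import Order.TTheory GRing.Theory Num.Theory.
Local Open Scope classical_set_scope.
Local Open Scope ring_scope.

(* [groupType] is the type of all groups, finite or infinite. *)
Definition subgroup (G : groupType) (H : set G) : Prop := group_closed (mem H).

Definition proper_subgroup (G : groupType) (H : set G) : Prop :=
  subgroup H /\ H <> setT.

Definition generates (G : groupType) (S : set G) : Prop :=
  smallest (@subgroup G) S = setT.

(* [has_rank G k]: [G] is finitely generated and [k] is the least cardinality
   of a generating set. *)
Definition has_rank (G : groupType) (k : nat) : Prop :=
  (exists S : {fset G}, generates [set` S] /\ #|` S| = k) /\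
  (forall S : {fset G}, generates [set` S] -> (k <= #|` S|)%N).

(* Multiplicities of [A] are kept, as [filter] acts on the enumeration of [A]
   with repetitions. *)
Definition mset_cap (G : groupType) (A : {mset G}%mset) (H : set G) :
    {mset G}%mset :=
  seq_mset [seq x <- A | x \in H].

(* The infimum is taken in the extended reals, so it is [+oo] when there is no
   proper subgroup (the trivial group). For [A] empty the quotient is [0 / 0],
   which is [0] here, so that [detection A] is at least [1]; nonemptiness of [A]
   has to be required separately. *)
Definition detection (R : realType) (G : groupType) (A : {mset G}%mset) :
    \bar R :=
  ereal_inf [set (1 - (size (mset_cap A H))%:R / (size A)%:R : R)%:E
            | H in @proper_subgroup G].

(* Main.v *)
(** Call an element bad for a proper subgroup [H] if it lies outside [H]; a
    product with exactly one bad factor is bad. Hence, if [n] elements are wired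
    to [n/2] products along a unique-neighbour expander, a set of [b > 0] bad
    elements with [b] at most a small fraction of [n] gives at least [4 b] bad
    products, whatever [H] is. As in the linear-time encodable codes of Gelfand,
    Dobrushin and Pinsker, put [A(x) = x ++ A(y) ++ w], where [y] consists of the
    expander products of [x] and [w] of those of [A(y)]. If many entries of [x]
    are bad, [x] alone suffices; otherwise some entry of [y] is bad, so by
    induction a fixed fraction of [A(y)] is bad, and [w] makes up for the
    dilution of that fraction caused by the added length. *)
Require Import Defs.
From mathcomp Require Import all_boot all_order all_algebra.
From mathcomp Require Import zify ring.

(** * Unique-neighbour expanders from a union bound *)

Section Expander.
Set Implicit Arguments.
Unset Strict Implicit.
Local Open Scope nat_scope.

Lemma leq_bin_exp2 n m : 'C(n, m) <= 2 ^ n.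
Proof.
have := max_card [set A : {set 'I_n} | #|A| == m].
rewrite card_draws card_ord => /leq_trans-> //.
by rewrite -cardsT -powersetT card_powerset cardsT card_ord.
Qed.

(** The falling factorial [(2 * t) ^_ t] has [t] factors, each at least [t]; hence [t ^ t] is at
    most [4 ^ t] times the factorial of [t]. *)
Lemma leq_bin_expn n t : 'C(n, t) * t ^ t <= (4 * n) ^ t.
Proof.
have leq_exp_fact : t ^ t <= 4 ^ t * t`!.
  apply: leq_trans (_ : (2 * t) ^_ t <= _).
    rewrite ffact_prod -[t in _ ^ t]card_ord -prod_nat_const.
    by apply: leq_prod => i _; have := ltn_ord i; lia.
  by rewrite -bin_ffact leq_mul2r (_ : 4 = 2 ^ 2) // -expnM leq_bin_exp2 orbT.
have leq_ffact_expn : n ^_ t <= n ^ t.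
  rewrite ffact_prod -[t in _ ^ t]card_ord -prod_nat_const.
  by apply: leq_prod => i _; lia.
apply: leq_trans (leq_mul (leqnn _) leq_exp_fact) _.
by rewrite mulnCA bin_ffact expnMn leq_mul2l leq_ffact_expn orbT.
Qed.

(** The summand [M] on the left keeps the sum strictly below [M] when [M > 0], as the union bound
    requires. *)
Lemma leq_sum_geom (F : nat -> nat) M n :
  (forall s, 0 < s <= n -> F s * 2 ^ s <= M) ->
  (\sum_(1 <= s < n.+1) F s) * 2 ^ n + M <= M * 2 ^ n.
Proof.
elim: n => [|n IHn] leFM; first by rewrite big_geq // expn0 !muln1.
have {}IHn : (\sum_(1 <= s < n.+1) F s) * 2 ^ n + M <= M * 2 ^ n.
  by apply: IHn => s /andP[s_gt0 le_sn]; apply: leFM; rewrite s_gt0 leqW.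
have := leFM n.+1; rewrite big_nat_recr //= leqnn => /(_ isT).
rewrite mulnDl !expnS; lia.
Qed.

(** A point of the image that is not covered exactly once accounts for at least two elements of
    [A]. *)
Lemma card_imset_leq_unique (aT rT : finType) (f : aT -> rT) (A : {set aT}) :
  2 * #|f @: A| <= #|A| + #|[set y | #|A :&: f @^-1: [set y]| == 1]|.
Proof.
have -> : #|A| = \sum_(y in f @: A) #|A :&: f @^-1: [set y]|.
  rewrite -sum1_card (partition_big_imset f) /=.
  apply: eq_bigr => y _; rewrite -sum1_card; apply: eq_bigl => x.
  by rewrite !inE.
have geU : \sum_(y in f @: A) (#|A :&: f @^-1: [set y]| == 1) <=
           #|[set y | #|A :&: f @^-1: [set y]| == 1]|.
  rewrite -sum1dep_card [leqRHS]big_mkcond /=.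
  rewrite big_mkcond; apply: leq_sum => y _.
  by do 2 case: ifP.
apply: leq_trans (leq_add (leqnn _) geU).
rewrite -big_split /= mulnC -sum_nat_const; apply: leq_sum => _ /imsetP[x xA ->].
have : 0 < #|A :&: f @^-1: [set f x]|.
  by apply/card_gt0P; exists x; rewrite !inE xA /=.
by case: #|_| => [|[|c]].
Qed.

Lemma card_ffun_maps_into (I J K : finType) (S : {set I}) (T : {set K}) :
  #|[set f : {ffun I * J -> K} | f @: setX S setT \subset T]| =
  #|T| ^ (#|J| * #|S|) * #|K| ^ (#|J| * #|~: S|).
Proof.
pose P (z : I * J) : pred K := if z.1 \in S then [in T] else predT.
have -> : #|[set f : {ffun I * J -> K} | f @: setX S setT \subset T]| =
          #|(family P : simpl_pred {ffun I * J -> K})|.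
  apply: eq_card => f; rewrite inE; apply/subsetP/familyP => [sT z|fP y].
    rewrite /P; case: ifP => // zS; apply: sT.
    by apply: imset_f; rewrite !inE zS.
  by case/imsetP => z; rewrite !inE andbT => zS ->; have := fP z; rewrite /P zS.
rewrite card_family foldrE big_map big_enum /=.
rewrite (bigID [in setX S setT]) /=; congr (_ * _).
  rewrite (eq_bigr (fun _ => #|T|)) => [|z]; last first.
    by rewrite !inE andbT /P => ->.
  by rewrite prod_nat_const cardsX cardsT mulnC.
rewrite (eq_bigr (fun _ => #|K|)) => [|z]; last first.
  by rewrite !inE andbT /P => /negPf ->.
rewrite prod_nat_const; congr (_ ^ _).
rewrite (eq_card (B := setX (~: S) setT)) => [|z]; last by rewrite [LHS]unfold_in !inE !andbT.
by rewrite cardsX cardsT mulnC.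
Qed.

Lemma leq_card_bigcup (I T : finType) (P : pred I) (F : I -> {set T}) :
  #|\bigcup_(i | P i) F i| <= \sum_(i | P i) #|F i|.
Proof.
elim/big_rec2: _ => [|i k A _ le_Ak]; first by rewrite cards0.
by apply: leq_trans (leq_card_setU _ _) _; rewrite leq_add2l.
Qed.

Lemma superset_of_card (T : finType) (A : {set T}) k :
  #|A| <= k <= #|T| -> exists2 B : {set T}, A \subset B & #|B| = k.
Proof.
move=> /andP[le_Ak le_kT].
have /card_geqP[s [uniq_s size_s sub_s]] : k - #|A| <= #|~: A|.
  by have := cardsC A; lia.
exists (A :|: [set:: s]); first exact: subsetUl.
rewrite cardsU (_ : A :&: _ = set0) ?cards0 ?subn0; last first.
  apply/setP => x; rewrite !inE; apply/andP => -[xA /sub_s].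
  by rewrite inE xA.
by rewrite cardsE (card_uniqP uniq_s) size_s subnKC.
Qed.

(* [36 = 6 ^ 2] and [4 ^ 6] come from the [6 * s] target vertices in
   [union_bound_term], [36 = 3 * 3 * 4] from [n <= 3 * m] and the bound on
   ['C(n, s)], and [2] makes the terms of the union bound decay geometrically. *)
Definition expansion_cst := 36 * 36 * (2 * 4 ^ 6).

(* The number of graphs for which the neighbourhood of some [S] with [#|S| = s]
   is contained in some [T] with [#|T| = 6 * s]. *)
Lemma union_bound_term n m s : n <= 3 * m -> 0 < s -> s * expansion_cst <= n ->
  'C(n, s) * 'C(m, 6 * s) * ((6 * s) ^ (8 * s) * m ^ (8 * (n - s))) * 2 ^ s
    <= m ^ (8 * n).
Proof.
move=> le_n3m s_gt0 le_sn.
have le_s_n : s <= n.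
  by apply: leq_trans le_sn; rewrite leq_pmulr.
(* The exponent is split to cancel the denominators [(6 * s) ^ (6 * s)] and [s ^ s] of the two
   binomial bounds; one [s ^ s] is left over. *)
have -> : (6 * s) ^ (8 * s) = (6 * s) ^ (6 * s) * 36 ^ s * s ^ s * s ^ s.
  rewrite (_ : 8 * s = 6 * s + 2 * s); last lia.
  by rewrite expnD (expnM _ 2) -!mulnA -!expnMn; congr (_ * _ ^ _); lia.
have -> : m ^ (8 * n) = m ^ (6 * s) * (m * m) ^ s * m ^ (8 * (n - s)).
  by rewrite mulnn -expnM -!expnD; congr (_ ^ _); lia.
have le1 := leq_bin_expn n s; have le2 := leq_bin_expn m (6 * s).
have le3 : (4 * n * 36 * s * 4 ^ 6 * 2) ^ s <= (m * m) ^ s.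
  rewrite leq_exp2r //; move: le_sn; rewrite /expansion_cst.
  move: (4 ^ 6) => c le_sn.
  have le_m : s * (4 * 3 * 36 * (c * 2)) <= m by nia.
  by nia.
have le4 := leq_mul (leq_mul le1 le2)
  (leqnn (36 ^ s * s ^ s * 2 ^ s * m ^ (8 * (n - s)))).
apply: leq_trans (_ : (4 * n * 36 * s * 4 ^ 6 * 2) ^ s * m ^ (6 * s) *
                      m ^ (8 * (n - s)) <= _).
  apply: leq_trans (leq_trans le4 _).
    by apply/eq_leq; ring.
  by apply/eq_leq; rewrite !expnMn [6 * s]mulnC (expnM 4); ring.
by rewrite leq_mul2r [leqRHS]mulnC leq_mul2r le3 !orbT.
Qed.

(* A uniformly random left-regular bipartite graph of degree 8 works: if the
   neighbourhood of [S] has at least [6 * #|S|] elements, then the [8 * #|S|]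
   edges leaving [S] leave at least [4 * #|S|] neighbours covered only once. *)
Lemma unique_neighbor_expander n :
  exists F : 'I_n./2 -> {set 'I_n}, forall S : {set 'I_n},
    0 < #|S| -> #|S| * expansion_cst <= n ->
    4 * #|S| <= #|[set j | #|F j :&: S| == 1]|.
Proof.
have [lt_n_cst | le_cst_n] := ltnP n expansion_cst.
  exists (fun=> set0) => S S_gt0; rewrite leqNgt (leq_trans lt_n_cst) //.
  by rewrite leq_pmull.
have cst_gt : 100 < expansion_cst.
  rewrite /expansion_cst; have: 0 < 4 ^ 6 by rewrite expn_gt0.
  by move: (4 ^ 6) => c; lia.
set m := n./2.
have le_n3m : n <= 3 * m by rewrite /m; lia.
have m_gt0 : 0 < m by rewrite /m; lia.
(* [f (x, d)] is the end of the [d]-th edge at [x]; parallel edges are allowed. *)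
pose bad s := \bigcup_(S in [set S : {set 'I_n} | #|S| == s])
  \bigcup_(T in [set T : {set 'I_m} | #|T| == 6 * s])
    [set f : {ffun 'I_n * 'I_8 -> 'I_m} | f @: setX S setT \subset T].
(* The cut-off to 0 lets the geometric bound hold for all [s]. *)
pose F s := if s * expansion_cst <= n then
  'C(n, s) * 'C(m, 6 * s) * ((6 * s) ^ (8 * s) * m ^ (8 * (n - s))) else 0.
have card_bad s : s * expansion_cst <= n -> #|bad s| <= F s.
  move=> le_sn; rewrite /F le_sn -mulnA.
  apply: leq_trans (leq_card_bigcup _ _) _.
  rewrite -[n in 'C(n, s)]card_ord -card_draws -sum_nat_const.
  apply: leq_sum => S; rewrite inE => /eqP cS.
  apply: leq_trans (leq_card_bigcup _ _) _.
  rewrite -[m in 'C(m, _)]card_ord -card_draws -sum_nat_const.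
  apply: leq_sum => T; rewrite inE => /eqP cT.
  rewrite card_ffun_maps_into cT cS !card_ord (_ : #|~: S| = n - s) //.
  by have := cardsC S; rewrite card_ord; lia.
have [f fP] : exists f : {ffun 'I_n * 'I_8 -> 'I_m}, forall s, 0 < s ->
    s * expansion_cst <= n -> f \notin bad s.
  pose badU := \bigcup_(s < n.+1 | (0 < s) && (s * expansion_cst <= n)) bad s.
  suff: #|badU| < #|{: {ffun 'I_n * 'I_8 -> 'I_m}}|.
    rewrite -cardsT => ltU; have /subsetPn[f _ fU] : ~~ ([set: _] \subset badU).
      by apply: contraL ltU => /subset_leq_card; rewrite -leqNgt.
    exists f => s s_gt0 le_sn; apply: contra fU => fs.
    have lt_sn : s < n.+1.
      by rewrite ltnS; apply: leq_trans le_sn; rewrite leq_pmulr // ltnW // ltnW.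
    by apply/bigcupP; exists (Ordinal lt_sn); rewrite //= s_gt0.
  rewrite card_ffun card_prod !card_ord [n * 8]mulnC.
  apply: (@leq_ltn_trans (\sum_(1 <= s < n.+1) F s)).
    apply: leq_trans (leq_card_bigcup _ _) _.
    apply: (@leq_trans (\sum_(s < n.+1 | (0 < s) && (s * expansion_cst <= n)) F s)).
      by apply: leq_sum => s /andP[_ /card_bad].
    rewrite big_mkcond big_ord_recl /= big_add1 big_mkord /=.
    by apply: leq_sum => s _; case: ifP.
  have M_gt0 : 0 < m ^ (8 * n) by rewrite expn_gt0 m_gt0.
  have /leq_sum_geom : forall s, 0 < s <= n -> F s * 2 ^ s <= m ^ (8 * n).
    move=> s /andP[s_gt0 _]; rewrite /F; case: ifP => // le_sn.
    exact: union_bound_term.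
  by rewrite -(ltn_pmul2r (expn_gt0 2 n)); apply: leq_trans; lia.
exists (fun j => [set x | [exists d, f (x, d) == j]]) => S S_gt0 le_Sn.
have le_6S : 6 * #|S| <= #|f @: setX S setT|.
  rewrite leqNgt; apply/negP => lt_6S.
  have /negP[] := fP _ S_gt0 le_Sn.
  have le_6Sm : 6 * #|S| <= #|[set: 'I_m]|.
    by rewrite cardsT card_ord; nia.
  have [T sfT cT] : exists2 T : {set 'I_m}, f @: setX S setT \subset T &
      #|T| = 6 * #|S|.
    by apply: superset_of_card; rewrite ltnW // -cardsT.
  by apply/bigcupP; exists S; rewrite ?inE //; apply/bigcupP; exists T; rewrite ?inE ?cT.
have := card_imset_leq_unique f (setX S setT).
rewrite cardsX cardsT card_ord => le_u.
apply: leq_trans (_ : #|[set y | #|setX S setT :&: f @^-1: [set y]| == 1]| <= _).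
  rewrite -(leq_add2l (#|S| * 8)); apply: leq_trans le_u.
  by apply: leq_trans (leq_mul (leqnn 2) le_6S); lia.
(* A single edge from [S] into [y] gives a single neighbour in [S]; parallel edges can break the
   converse. *)
apply/subset_leq_card/subsetP => y; rewrite !inE => /cards1P[[x d] eq_xd].
apply/cards1P; exists x; apply/setP => z; rewrite !inE.
have in_xd z' d' : (z' \in S) && (f (z', d') == y) = ((z', d') == (x, d)).
  by have /setP/(_ (z', d')) := eq_xd; rewrite !inE andbT.
apply/andP/eqP => [[/existsP[d' fz] zS] | ->].
  by have := in_xd z d'; rewrite zS fz => /esym/eqP[].
by have := in_xd x d; rewrite eqxx => /andP[xS fx]; split=> //; apply/existsP; exists d.
Qed.

End Expander.

(** * Products along an expander, and the recursive construction *)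

Section Groups.
Set Implicit Arguments.
Unset Strict Implicit.
Local Open Scope nat_scope.

Notation outside H := (count (fun g => g \notin H)).

(** If the product lay in [H], cancelling the products on either side of [x i], both in [H], would
    put [x i] in [H]; [uniq s] keeps [i] out of these. *)
Lemma prod_notin (G : groupType) (H : {pred G}) (x : nat -> G) (s : seq nat) i :
  group_closed H -> uniq s -> i \in s -> x i \notin H ->
  (forall j, j \in s -> j != i -> x j \in H) ->
  (\prod_(j <- s) x j)%g \notin H.
Proof.
move=> Hg + i_s xi xj; have HM := group_closedM Hg; have HV := group_closedV Hg.
case/splitPr: i_s xj => s1 s2 xj.
rewrite cat_uniq /= => /and4P[_ /norP[i_s1 _] i_s2 _].
have prodH r : {subset r <= s1 ++ i :: s2} -> i \notin r -> (\prod_(j <- r) x j)%g \in H.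
  move=> sub_r i_r; rewrite big_seq; apply: (big_ind [in H]) => [||j jr].
  - exact: Hg.1.
  - by move=> u v; apply: HM.
  - by apply: xj; [exact: sub_r | apply: contra i_r => /eqP <-].
have p1H : (\prod_(j <- s1) x j)%g \in H.
  by apply: prodH => // j js; rewrite mem_cat js.
have p2H : (\prod_(j <- s2) x j)%g \in H.
  by apply: prodH => // j js; rewrite mem_cat inE js !orbT.
rewrite big_cat big_cons /=; apply: contra xi => pH.
have -> : x i = ((\prod_(j <- s1) x j)^-1 *
    (\prod_(j <- s1) x j * (x i * \prod_(j <- s2) x j)) *
    (\prod_(j <- s2) x j)^-1)%g by rewrite mulKg mulgK.
exact: HM (HM _ _ (HV _ p1H) pH) (HV _ p2H).
Qed.

(** The wiring depends only on [size x], so one [y] serves all [H]. Bad entries are counted as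
    positions, so repetitions in [x] do no harm. *)
Lemma expander_products (G : groupType) (x : seq G) :
  exists2 y : seq G, size y = (size x)./2 &
    forall H : {pred G}, group_closed H -> 0 < outside H x ->
      outside H x * expansion_cst <= size x ->
      4 * outside H x <= outside H y.
Proof.
have [F FP] := unique_neighbor_expander (size x).
pose nbrs j := [seq val i | i <- enum (F j)].
exists [seq (\prod_(i <- nbrs j) nth 1 x i)%g | j <- enum 'I_(size x)./2].
  by rewrite size_map size_enum_ord.
move=> H Hg.
pose S := [set i : 'I_(size x) | nth 1%g x i \notin H].
have -> : outside H x = #|S|.
  by rewrite -sum1_count (big_nth 1%g) big_mkord sum1dep_card.
move=> S_gt0 le_S; apply: leq_trans (FP S S_gt0 le_S) _.
rewrite count_map -sum1_count big_enum_cond sum1dep_card.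
apply/subset_leq_card/subsetP => j; rewrite !inE /= => /cards1P[i eq_i].
have /setIP[Fi Si] : i \in F j :&: S by rewrite eq_i set11.
apply: (@prod_notin _ _ _ _ (val i)) => //.
- by rewrite map_inj_uniq ?enum_uniq //; exact: val_inj.
- by rewrite map_f ?mem_enum.
- by move: Si; rewrite inE.
move=> _ /mapP[l Fl ->]; rewrite mem_enum in Fl.
apply: contraNT => Hl; have : l \in F j :&: S by rewrite !inE Fl.
by rewrite eq_i => /set1P->.
Qed.

Lemma detecting_seq (G : groupType) (x : seq G) :
  exists A : seq G, [/\ size x <= size A, size A <= 4 * size x &
    forall H : {pred G}, group_closed H -> 0 < outside H x ->
      size A <= outside H A * (12 * expansion_cst)].
Proof.
have [n le_xn] := ubnP (size x); elim: n => // n IHn in x le_xn *.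
have cst_gt1 : 1 < expansion_cst by [].
have [le_x | lt_x] := leqP (size x) expansion_cst.
  exists x; split=> [//||H _ out_x]; first by rewrite leq_pmull.
  apply: leq_trans le_x _.
  by apply: leq_trans (leq_pmull _ out_x) _; rewrite leq_mul2l leq_pmull ?orbT.
have [y size_y yP] := expander_products x.
have [|B [le_yB le_By BP]] := IHn y; first by rewrite size_y; lia.
have [w size_w wP] := expander_products B.
exists (x ++ B ++ w); rewrite !size_cat size_w; rewrite size_y in le_yB le_By.
(* The factor 4 reproduces itself: [B] has at most [2 * size x] entries and [w] at most [size x]. *)
split=> [||H Hg out_x]; [lia | lia |].
rewrite !count_cat.
have [le_out | lt_out] := ltnP (size x) (outside H x * expansion_cst).
  by move: cst_gt1 le_out; move: expansion_cst => E; nia.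
have out_y : 0 < outside H y by apply: leq_trans (yP H Hg out_x lt_out); lia.
have le_B := BP H Hg out_y.
have := wP H Hg; move: cst_gt1 lt_x lt_out le_B.
move: expansion_cst (outside H B) (outside H w) => E b c *.
(* Either [b] alone suffices, or it is small enough for the expander on [B] to give [c >= 4 * b];
   then [5 * size B] covers the total length, as [size x <= 2 * size B + 1]. *)
have [|lt_b] := leqP (size B + (size B)./2 + size x) (b * (12 * E)).
  nia.
nia.
Qed.

End Groups.

(* From sequences to the detection probability *)
From mathcomp Require Import finmap multiset.
From mathcomp Require Import boolp classical_sets reals constructive_ereal ereal.

Import Order.TTheory GRing.Theory Num.Theory.
Local Open Scope ring_scope.

Theorem theorem1p1 (R : realType) :
  exists delta0 C0 : R, [/\ 0 < delta0, 1 < C0 &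
    forall (k : nat) (G : groupType), has_rank G k ->
      exists A : {mset G}%mset,
        [/\ (size A)%:R <= C0 * k%:R,
            (0 < k)%N -> A <> mset0 &
            (delta0%:E <= detection R A)%E]].
Proof.
have E_gt1 : (1 < expansion_cst)%N by [].
exists ((12 * expansion_cst)%N%:R^-1), 4; split.
- by rewrite invr_gt0 ltr0n; lia.
- by rewrite ltr1n.
move=> k G [[S [genS cardS]] _].
have [A [le_SA le_A AP]] := detecting_seq S.
have perm_A := perm_eq_seq_mset A; have size_A := perm_size perm_A.
exists (seq_mset A); rewrite size_A -cardS; split.
- by rewrite -natrM ler_nat.
- by move=> S_gt0 A0; have := leq_trans S_gt0 le_SA; rewrite -size_A A0 size_mset0.
apply: le_ereal_inf_tmp => _ [H [Hg HnT] <-].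
rewrite lee_fin size_A /mset_cap (perm_size (perm_eq_seq_mset _)) size_filter.
rewrite (permP perm_A).
have out_S : (0 < count (fun g => g \notin mem H) S)%N.
  rewrite -has_count; apply: contra_notT HnT => /hasPn SH.
  apply/seteqP; split=> // g; rewrite -genS; apply: smallest_sub => // h hS.
  by have := SH h hS; rewrite negbK inE.
have le_A_out := AP (mem H) Hg out_S.
(* Division by 0 gives 0, so writing 1 as a quotient by [size A] needs [A] nonempty; the bad entry
   of [S] ensures this. *)
have A_gt0 : (0 < size A)%N.
  by apply: leq_trans le_SA; apply: leq_trans out_S (count_size _ _).
have := count_predC [in H] A.
set c := count _ A; set b := count _ A => cbA.
have -> : 1 - c%:R / (size A)%:R = b%:R / (size A)%:R :> R.
  rewrite -[X in X - _](@divff _ (size A)%:R) ?pnatr_eq0 -?lt0n //.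
  by rewrite -mulrBl -cbA natrD addrAC subrr add0r.
rewrite ler_pdivlMr ?ltr0n // ler_pdivrMl ?ltr0n; last lia.
by rewrite -natrM ler_nat mulnC.
Qed.
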